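(* Let $K$ be an infinite field of characteristic different from $2$ and $3$ and let $n\ge 3$. Then $$Z(F_2^{(n)})=F_2^{(n)}\cap Z(F^{(n)}).$$
   Context: Commutators: $[a_1,a_2]=a_1a_2-a_2a_1$ and $[a_1,\dots,a_n]=[[a_1,\dots,a_{n-1}],a_n]$. $F$ is the free unital associative $K$-algebra on the countable set $X=\{x_1,x_2,\dots\}$, $T^{(n)}$ is the two-sided ideal of $F$ generated by all $[a_1,\dots,a_n]$, $a_i\in F$, and $F^{(n)}=F/T^{(n)}$. $F_2^{(n)}$ is the unital subalgebra of $F^{(n)}$ generated by the images of $x_1,x_2$. $Z(A)$ denotes the center of $A$. *)

(* Defs.v *)
From HB Require Import structures.
From mathcomp Require Import all_boot all_algebra.
From mathcomp Require Import boolp classical_sets cardinality.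
From mathcomp.multinomials Require Import monalg.

Set Implicit Arguments.
Unset Strict Implicit.
Unset Printing Implicit Defensive.

Import GRing.Theory.

Local Open Scope quotient_scope.
Local Open Scope classical_set_scope.
Local Open Scope ring_scope.

Definition commutator (R : pzRingType) (a b : R) : R := a * b - b * a.

(* [:: a_1; ...; a_n] is sent to [a_1, ..., a_n] = [[a_1, ..., a_(n-1)], a_n],
   and [:: a_1] to a_1; the value 0 on [::] is a dummy. *)
Definition lcommutator (R : pzRingType) (s : seq R) : R :=
  if s is a :: s' then foldl (@commutator R) a s' else 0.

Definition two_sided_ideal (R : pzRingType) (I : set R) : Prop :=
  [/\ I 0,
      forall x y, I x -> I y -> I (x - y),
      forall a x, I x -> I (a * x)
    & forall a x, I x -> I (x * a)].

Definition ideal_gen (R : pzRingType) (G : set R) : set R :=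
  smallest (@two_sided_ideal R) G.

Definition subalg_gen (K : pzRingType) (A : lalgType K) (G : set A) : set A :=
  smallest (fun S : set A => GRing.subalg_closed (mem S)) G.

(* The center of S, for S a subalgebra of R: the elements of S that commute
   with all of S. The center of R itself is [center [set: R]]. *)
Definition center (R : pzRingType) (S : set R) : set R :=
  [set z | S z /\ forall a, S a -> GRing.comm z a].

Lemma ideal_gen_ideal (R : pzRingType) (G : set R) :
  two_sided_ideal (ideal_gen G).
Proof.
split=> [I [[]] //|x y Ix Iy|a x Ix|a x Ix] I hI; have [[h0 hB hl hr] _] := hI.
- by apply: hB; [exact: Ix | exact: Iy].
- by apply: hl; exact: Ix.
- by apply: hr; exact: Ix.
Qed.

(* ring_quotient only equips quotients of commutative rings with a
   multiplication; this is the quotient A / I of a K-algebra A by a two-sided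
   ideal I. The ideal is required to be proper because an algType is nonzero. *)
Section QuotientAlgebra.
Variables (K : nzRingType) (A : algType K) (I : set A).
Hypotheses (idI : two_sided_ideal I) (I1 : ~ I 1).

Definition ideal_pred of two_sided_ideal I : {pred A} := fun x => `[< I x >].

Let ideal_predE x : (x \in ideal_pred idI) = `[< I x >]. Proof. by []. Qed.

Let ideal_pred_zmod : zmod_closed (ideal_pred idI).
Proof.
have [h0 hB _ _] := idI; split=> [|x y]; rewrite !ideal_predE; first exact/asboolP.
by move=> /asboolP Ix /asboolP Iy; apply/asboolP; exact: hB.
Qed.

HB.instance Definition _ :=
  GRing.isZmodClosed.Build A (ideal_pred idI) ideal_pred_zmod.

Definition quot_alg of ~ I 1 := @Quotient.quot A (ideal_pred idI).

Local Notation Q := (quot_alg I1).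

HB.instance Definition _ := Choice.on Q.
HB.instance Definition _ := EqQuotient.on Q.
HB.instance Definition _ := GRing.Zmodule.on Q.
HB.instance Definition _ :=
  @isZmodQuotient.Build A (Quotient.equiv (ideal_pred idI)) 0 -%R +%R Q
    (@pi_zeror _ _ _ _ _ _) (@pi_oppr _ _ _ _ _ _) (@pi_addr _ _ _ _ _ _).

Lemma quot_algP (x y : A) : reflect (I (x - y)) (x == y %[mod Q]).
Proof. by rewrite piE Quotient.equivE ideal_predE; exact: asboolP. Qed.

Definition qone : Q := lift_cst Q 1.
Definition qmul := lift_op2 Q *%R.
Definition qscale (k : K) := lift_op1 Q ( *:%R k).

Canonical pi_qone_morph := PiConst qone.

Lemma pi_qmul : {morph \pi_Q : x y / x * y >-> qmul x y}.
Proof.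
move=> x y; unlock qmul; apply/eqP/quot_algP.
have [_ hB hl hr] := idI.
have hx (z : A) : I (repr (\pi_Q z) - z) by apply/quot_algP; rewrite reprK.
set x' := repr _; set y' := repr _.
have -> : x * y - x' * y' = - ((x' - x) * y) - x' * (y' - y).
  by rewrite mulrBl mulrBr !opprB addrA subrK.
by apply: hB; [rewrite -mulrN; exact: hr (hx x) | exact: hl (hx y)].
Qed.
Canonical pi_qmul_morph := PiMorph2 pi_qmul.

Lemma pi_qscale k : {morph \pi_Q : x / k *: x >-> qscale k x}.
Proof.
move=> x; unlock qscale; apply/eqP/quot_algP.
have [_ _ hl _] := idI.
rewrite -scalerBr -mulr_algl; apply: hl.
by apply/quot_algP; rewrite reprK.
Qed.
Canonical pi_qscale_morph k := PiMorph1 (pi_qscale k).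

Let qmulA : associative qmul.
Proof. by elim/quotW=> x; elim/quotW=> y; elim/quotW=> z; rewrite !piE mulrA. Qed.

Let qmul1q : left_id qone qmul.
Proof. by elim/quotW=> x; rewrite !piE mul1r. Qed.

Let qmulq1 : right_id qone qmul.
Proof. by elim/quotW=> x; rewrite !piE mulr1. Qed.

Let qmulDl : left_distributive qmul +%R.
Proof. by elim/quotW=> x; elim/quotW=> y; elim/quotW=> z; rewrite !piE mulrDl. Qed.

Let qmulDr : right_distributive qmul +%R.
Proof. by elim/quotW=> x; elim/quotW=> y; elim/quotW=> z; rewrite !piE mulrDr. Qed.

Let qone_neq0 : qone != 0.
Proof. by rewrite piE Quotient.equivE subr0 ideal_predE; apply/asboolPn. Qed.

HB.instance Definition _ := GRing.Zmodule_isNzRing.Build Q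
  qmulA qmul1q qmulq1 qmulDl qmulDr qone_neq0.
HB.instance Definition _ :=
  @isNzRingQuotient.Build A (Quotient.equiv (ideal_pred idI)) 0 -%R +%R 1 *%R Q
    (lock _) pi_qmul.

Let qscaleA (k l : K) (x : Q) : qscale k (qscale l x) = qscale (k * l) x.
Proof. by elim/quotW: x => x; rewrite !piE scalerA. Qed.

Let qscale1 : left_id 1 qscale.
Proof. by elim/quotW=> x; rewrite !piE scale1r. Qed.

Let qscaleDr : right_distributive qscale +%R.
Proof. by move=> k; elim/quotW=> x; elim/quotW=> y; rewrite !piE scalerDr. Qed.

Let qscaleDl (x : Q) : {morph qscale^~ x : k l / k + l}.
Proof. by elim/quotW: x => x k l; rewrite !piE scalerDl. Qed.

HB.instance Definition _ := GRing.Zmodule_isLmodule.Build K Q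
  qscaleA qscale1 qscaleDr qscaleDl.

Let qscaleAl (k : K) (x y : Q) : k *: (x * y) = (k *: x) * y.
Proof.
elim/quotW: x => x; elim/quotW: y => y.
by rewrite /GRing.scale /= !piE scalerAl.
Qed.

Let qscaleAr (k : K) (x y : Q) : k *: (x * y) = x * (k *: y).
Proof.
elim/quotW: x => x; elim/quotW: y => y.
by rewrite /GRing.scale /= !piE scalerAr.
Qed.

HB.instance Definition _ := GRing.Lmodule_isLalgebra.Build K Q qscaleAl.
HB.instance Definition _ := GRing.Lalgebra_isAlgebra.Build K Q qscaleAr.

End QuotientAlgebra.

(* The free unital associative K-algebra on countably many generators, as the
   algebra of the free monoid on nat. The generators are indexed from 0, so
   that x_1, x_2, ... are [freeX K 0], [freeX K 1], ... *)
Definition free_alg (K : fieldType) := {malg K[{fmonom nat}]}.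

HB.instance Definition _ (K : fieldType) := GRing.Lalgebra.on (free_alg K).

Definition freeX (K : fieldType) (i : nat) : free_alg K := << fmu i >>.

(* monalg only provides an algType when the monoid is commutative. *)
Lemma free_alg_scaleAr (K : fieldType) (k : K) (x y : free_alg K) :
  k *: (x * y) = x * (k *: y).
Proof.
have malgCC (z : free_alg K) : z * k%:MP = k%:MP * z.
  rewrite [LHS]fgmulgU [RHS]fgmulUg; apply: eq_bigr => m _.
  by rewrite mulrC mulm1 mul1m.
by rewrite -!mul_malgC !mulrA malgCC.
Qed.

HB.instance Definition _ (K : fieldType) :=
  GRing.Lalgebra_isAlgebra.Build K (free_alg K) (@free_alg_scaleAr K).

Section RelativelyFree.
Variables (K : fieldType) (n : nat).

Definition T_ideal : set (free_alg K) :=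
  ideal_gen [set lcommutator (a : seq (free_alg K)) |
             a in [set: n.-tuple (free_alg K)]].

Lemma T_ideal_proper : (1 < n)%N -> ~ T_ideal 1.
Proof.
pose c0 : {malg K[{fmonom nat}]} -> K := mcoeff mone.
have c0M (x y : free_alg K) : c0 (x * y) = c0 x * c0 y.
  exact: (rmorphM (mcoeff (mone : {fmonom nat}))).
have c0B (x y : free_alg K) : c0 (x - y) = c0 x - c0 y.
  exact: (raddfB (mcoeff (mone : {fmonom nat}))).
move=> n_gt1 T1.
suff : c0 1 = 0 by move/eqP; rewrite /c0 mcoeff1 eqxx oner_eq0.
apply: (T1 [set x : free_alg K | c0 x = 0]); split.
  split=> /= [|x y x0 y0|a x x0|a x x0].
  - exact: mcoeff0.
  - by rewrite c0B x0 y0 subrr.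
  - by rewrite c0M x0 mulr0.
  - by rewrite c0M x0 mul0r.
move=> _ [[a /= /eqP size_a] _ <-] /=; move: n_gt1; rewrite -size_a.
case: a {size_a} => [|b s] //=.
elim/last_ind: s => [|s c _] // _.
by rewrite foldl_rcons c0B !c0M mulrC subrr.
Qed.

Variable n_gt1 : (1 < n)%N.

(* F^(n) = F / T^(n); since T^(1) = F, only n > 1 gives a (nonzero) algebra. *)
Definition rel_free := quot_alg (@ideal_gen_ideal _ _) (T_ideal_proper n_gt1).

HB.instance Definition _ := GRing.Algebra.on rel_free.
HB.instance Definition _ := EqQuotient.on rel_free.

Definition rel_free2 : set rel_free :=
  subalg_gen [set \pi_rel_free (freeX K 0); \pi_rel_free (freeX K 1)].

End RelativelyFree.

Arguments rel_free K {n} n_gt1.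
Arguments rel_free2 K {n} n_gt1 _.

(* Main.v *)
Require Import Defs.
From HB Require Import structures.
From mathcomp Require Import all_boot all_algebra.
From mathcomp Require Import boolp classical_sets cardinality.
From mathcomp.multinomials Require Import monalg.

Set Implicit Arguments.
Unset Strict Implicit.
Unset Printing Implicit Defensive.

(** Let A be the free algebra on x, y. Over two generators the form
    [l, a] [b, c] is alternating and a derivation in each argument modulo the
    left A-span of the brackets [l, p_1, ..., p_k], k >= 2, hence vanishes
    there. So these spans form a filtration that is additive under products with
    commutators, whence [T^(k)(A), A] <= T^(k+1)(A) and
    T^(m)(A) [z, w_1, ..., w_j] <= T^(m+j) for w_i in A.

    The elements that are linear in an extra variable z are uniquely the sums of
    a_w [z, w_1, ..., w_j] over words w in x, y; such a sum lies in T^(n) as soon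
    as all a_w are in T^(n-j)(A), and twisted derivations map T^(n)(A) to sums of
    this kind. Linearizing [f, x], [f, y] in T^(n) along x |-> x + z and
    y |-> y + z gives [f, z] + [h, x] and [f, z] + [k, y] in T^(n), with h and k
    linear in z. Comparing the coefficients of [h, x] and [k, y] at words ending
    in x and in y shows by descending induction on the length of w that h and k
    have coefficients one step deeper than required, so [h, x] and with it
    [f, z] is in T^(n). *)

Import GRing.Theory.
Local Open Scope classical_set_scope.
Local Open Scope ring_scope.

(** * Commutator identities *)

Section Commutators.
Variable R : pzRingType.
Implicit Types a b c l : R.

Lemma commutatorDl a b c : commutator (a + b) c = commutator a c + commutator b c.
Proof. by rewrite /commutator mulrDl mulrDr opprD addrACA. Qed.

Lemma commutatorN a b : - commutator a b = commutator b a.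
Proof. by rewrite /commutator opprB. Qed.

Lemma commutatorBl a b c : commutator (a - b) c = commutator a c - commutator b c.
Proof. by rewrite commutatorDl /commutator mulNr mulrN !opprD. Qed.

Lemma commutatorMl a b c :
  commutator (a * b) c = a * commutator b c + commutator a c * b.
Proof. by rewrite /commutator mulrBr mulrBl !mulrA subrKA. Qed.

Lemma commutatorMr a b c :
  commutator a (b * c) = b * commutator a c + commutator a b * c.
Proof. by rewrite /commutator mulrBr mulrBl !mulrA [RHS]addrC subrKA. Qed.

Lemma mulrC_commutator a b : a * b = b * a + commutator a b.
Proof. by rewrite /commutator addrCA subrr addr0. Qed.

Lemma commutator_central a b : GRing.comm a b -> commutator b a = 0.
Proof. by move=> ab; rewrite /commutator ab subrr. Qed.

Lemma commutatorxx a : commutator a a = 0.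
Proof. exact: subrr. Qed.

Lemma commutator0x a : commutator 0 a = 0.
Proof. by rewrite /commutator mul0r mulr0 subrr. Qed.

Lemma rcons_commutator l s c :
  foldl (@commutator R) l (rcons s c) = commutator (foldl (@commutator R) l s) c.
Proof. exact: foldl_rcons. Qed.

End Commutators.

Lemma rmorph_commutator (R S : pzRingType) (f : {rmorphism R -> S}) a b :
  f (commutator a b) = commutator (f a) (f b).
Proof. by rewrite /commutator rmorphB !rmorphM. Qed.

Lemma rmorph_lcommutator (R S : pzRingType) (f : {rmorphism R -> S}) a s :
  f (foldl (@commutator R) a s) = foldl (@commutator S) (f a) (map f s).
Proof. by elim: s a => //= b s IH a; rewrite IH rmorph_commutator. Qed.

(** * Two-sided ideals *)

Section Ideals.
Variables (R : pzRingType) (I : set R).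
Hypothesis idI : two_sided_ideal I.

Lemma tsideal0 : I 0. Proof. by case: idI. Qed.

Lemma tsidealB x y : I x -> I y -> I (x - y).
Proof. by case: idI => _ + _ _; exact. Qed.

Lemma tsidealN x : I x -> I (- x).
Proof. by rewrite -(sub0r x); exact: tsidealB tsideal0. Qed.

Lemma tsidealD x y : I x -> I y -> I (x + y).
Proof. by move=> Ix Iy; rewrite -[y]opprK; apply/tsidealB/tsidealN. Qed.

Lemma tsidealMl a x : I x -> I (a * x).
Proof. by case: idI => _ _ + _; exact. Qed.

Lemma tsidealMr a x : I x -> I (x * a).
Proof. by case: idI => _ _ _; exact. Qed.

End Ideals.

(* The paper's T^(k+1): the index counts the brackets, which makes it additive. *)
Definition lower (R : pzRingType) (k : nat) : set R :=
  ideal_gen [set foldl (@commutator R) p.1 p.2 |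
             p in [set p : R * seq R | size p.2 = k]].

(** * Ideals generated by left-normed commutators of a given length *)

Section Lower.
Variable R : pzRingType.

Lemma lower_ideal k : two_sided_ideal (@lower R k).
Proof. exact: ideal_gen_ideal. Qed.

Lemma lower_gen k (a : R) s : size s = k -> lower k (foldl (@commutator R) a s).
Proof. by move=> sk I [_]; apply; exists (a, s). Qed.

Lemma lower_ind k (J : set R) : two_sided_ideal J ->
  (forall a s, size s = k -> J (foldl (@commutator R) a s)) -> lower k `<=` J.
Proof. by move=> idJ Jgen x; apply; split=> // _ [[a s] /= sk <-]; exact: Jgen. Qed.

Lemma lower0 (x : R) : lower 0 x.
Proof. exact: (@lower_gen 0 x [::]). Qed.

Lemma lower_gen_le k (a : R) s : (k <= size s)%N -> lower k (foldl (@commutator R) a s).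
Proof.
(* The first [size s - k] entries are absorbed into the initial entry, which leaves exactly [k]
   brackets. *)
move=> ks; rewrite -(cat_take_drop (size s - k) s) foldl_cat; apply: lower_gen.
by rewrite size_drop subKn.
Qed.

Lemma lower_le j k : (j <= k)%N -> @lower R k `<=` lower j.
Proof.
move=> jk; apply: lower_ind (lower_ideal _) _ => a s sk.
by apply: lower_gen_le; rewrite sk.
Qed.

End Lower.
Arguments lower_ideal {R k}.

Lemma lower_rmorph (R S : pzRingType) (f : {rmorphism R -> S}) k x :
  lower k x -> lower k (f x).
Proof.
apply: (@lower_ind _ k [set x | lower k (f x)]).
  split=> [|a b fa fb|a b fb|a b fb] /=.
  - by rewrite rmorph0; exact: tsideal0 lower_ideal.
  - by rewrite rmorphB; exact: tsidealB lower_ideal _ _ _ _.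
  - by rewrite rmorphM; exact: tsidealMl lower_ideal _ _ _.
  - by rewrite rmorphM; exact: tsidealMr lower_ideal _ _ _.
by move=> a s sk /=; rewrite rmorph_lcommutator; apply: lower_gen; rewrite size_map.
Qed.

(** * Free algebras: induction principles and evaluation *)

Section FreeAlgebra.
Variables (K : fieldType) (I : choiceType).
Local Notation A := {malg K[{fmonom I}]}.

Lemma malgCMU (R : nzRingType) (k c : R) (m : {fmonom I}) :
  k%:MP * << c *g m >> = << k * c *g m >> :> {malg R[{fmonom I}]}.
Proof. by rewrite [LHS]fgmulUU mul1m. Qed.

Lemma malgUMl (R : nzRingType) (c : R) (m : {fmonom I}) :
  << c *g m >> = c%:MP * << m >> :> {malg R[{fmonom I}]}.
Proof. by rewrite malgCMU mulr1. Qed.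

Lemma malgC_central (R : nzRingType) (c : R) (b : {malg R[{fmonom I}]}) :
  (forall r, GRing.comm r c) -> GRing.comm b c%:MP.
Proof.
move=> cC; rewrite /GRing.comm [LHS]fgmulgU [RHS]fgmulUg.
by apply: eq_bigr => m _; rewrite cC mulm1 mul1m.
Qed.

Lemma malgC_comm (k : K) (a : A) : GRing.comm a k%:MP.
Proof. by apply: malgC_central => r; exact: mulrC. Qed.

Lemma malg_ind (R : nzRingType) (P : {malg R[{fmonom I}]} -> Prop) :
  P 0 -> (forall a b, P a -> P b -> P (a + b)) -> (forall c m, P << c *g m >>) ->
  forall a, P a.
Proof. by move=> P0 PD PU a; rewrite (monalgE a); exact: big_ind. Qed.

Lemma malgU_cons (R : nzRingType) (i : I) (s : seq I) :
  << FMonom (i :: s) >> = << fmu i >> * << FMonom s >> :> {malg R[{fmonom I}]}.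
Proof.
by rewrite [RHS]fgmulUU mulr1; congr << _ >>; apply/eqP; rewrite fmP fmM fmU.
Qed.

Lemma falg_ind (P : A -> Prop) :
  (forall k, P k%:MP) -> (forall i, P << fmu i >>) ->
  (forall a b, P a -> P b -> P (a + b)) ->
  (forall a b, P a -> P b -> P (a * b)) -> forall a, P a.
Proof.
move=> PC PX PD PM; apply: malg_ind => // [|c m].
  by rewrite -malgC0E.
rewrite malgUMl; apply: (PM _ _ (PC _)).
rewrite -(fmK m); elim: (fmonom_val m) => [|i s IH].
  by have := PC 1; rewrite /= -fmoneE.
by rewrite malgU_cons; exact: PM.
Qed.

Section Eval.
Variables (S : nzRingType) (iota : {rmorphism K -> S}) (g : I -> S).

(** The universal property of the free algebra. Centrality of the scalars is an argument, so that
    multiplicativity can be attached to [feval] as an instance. *)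
Definition feval of (forall k s, GRing.comm s (iota k)) : A -> S :=
  mmap iota (fun m => \prod_(i <- fmonom_val m) g i).

Variable iotaC : forall k s, GRing.comm s (iota k).

HB.instance Definition _ := GRing.Additive.on (feval iotaC).

Let fprod (m : {fmonom I}) : S := \prod_(i <- fmonom_val m) g i.

Let fprodM : mmorphism fprod.
Proof. by split=> [x y|]; rewrite /fprod ?fm1 ?fmM ?big_nil ?big_cat. Qed.

HB.instance Definition _ := isMultiplicative.Build _ _ fprod fprodM.

Let feval_multiplicative : multiplicative (feval iotaC).
Proof.
by apply: (@commr_mmap_is_multiplicative _ _ _ iota fprod) => x m m'; exact/commr_sym/iotaC.
Qed.

HB.instance Definition _ :=
  GRing.isMultiplicative.Build A S (feval iotaC) feval_multiplicative.

Lemma fevalC k : feval iotaC k%:MP = iota k.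
Proof. by rewrite /feval mmapU /= fm1 big_nil mulr1. Qed.

Lemma fevalX i : feval iotaC << fmu i >> = g i.
Proof. by rewrite /feval mmapU /= rmorph1 mul1r fmU big_seq1. Qed.

End Eval.
End FreeAlgebra.

(** * Spans of the brackets that start with a fixed element, over two generators *)

Section AdjointSpan.
Variables (K : fieldType) (R : nzRingType).
Hypothesis two_neq0 : 2%:R != 0 :> K.
Local Notation A := {malg K[{fmonom bool}]}.
Variable phi : {rmorphism A -> R}.
Variable l : R.

Local Notation br s := (foldl (@commutator R) l (map phi s)).

(** Coefficients stand on the left only; [adspanMr] gives stability on the right. *)
Inductive adspan (r : nat) : R -> Prop :=
| adspan0 : adspan r 0
| adspan_cons a s x of (r <= size s)%N & adspan r x : adspan r (phi a * br s + x).

Lemma adspan_gen r a s : (r <= size s)%N -> adspan r (phi a * br s).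
Proof. by move=> rs; rewrite -[phi a * _]addr0; exact/adspan_cons/adspan0. Qed.

Lemma adspan_br r s : (r <= size s)%N -> adspan r (br s).
Proof. by move=> rs; rewrite -[br s]mul1r -(rmorph1 phi); exact: adspan_gen. Qed.

Lemma adspanD r x y : adspan r x -> adspan r y -> adspan r (x + y).
Proof.
move=> Ix Iy; elim: Ix => [|a s z rs _ IH]; first by rewrite add0r.
by rewrite -addrA; exact: adspan_cons.
Qed.

Lemma adspanMl r a x : adspan r x -> adspan r (phi a * x).
Proof.
elim=> [|b s z rs _ IH]; first by rewrite mulr0; exact: adspan0.
by rewrite mulrDr mulrA -rmorphM; exact: adspan_cons.
Qed.

Lemma adspanN r x : adspan r x -> adspan r (- x).
Proof. by rewrite -mulN1r -(rmorphN1 phi); exact: adspanMl. Qed.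

Lemma adspanB r x y : adspan r x -> adspan r y -> adspan r (x - y).
Proof. by move=> Ix Iy; apply/adspanD/adspanN. Qed.

Lemma br_commutator s a : commutator (br s) (phi a) = br (rcons s a).
Proof. by rewrite map_rcons rcons_commutator. Qed.

(** Moving [phi a] to the left past a bracket leaves a bracket with one more entry, which is still
    in the span. *)
Lemma adspanMr r a x : adspan r x -> adspan r (x * phi a).
Proof.
elim=> [|b s z rs _ IH]; first by rewrite mul0r; exact: adspan0.
rewrite mulrDl; apply: adspanD => //.
rewrite -mulrA (mulrC_commutator (br s)) br_commutator mulrDr mulrA -rmorphM.
by apply: adspanD; apply: adspan_gen; rewrite ?size_rcons ?leqW.
Qed.

Lemma adspan_half r x : adspan r (x + x) -> adspan r x.
Proof.
move=> Ixx; suff -> : x = phi (2%:R^-1)%:MP * (x + x) by exact: adspanMl.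
have half : 2%:R^-1 + 2%:R^-1 = 1 :> K by rewrite -[LHS]mulr2n -[LHS]mulr_natr mulVf.
by rewrite mulrDr -mulrDl -rmorphD -rmorphD half !rmorph1 mul1r.
Qed.

Section Alternation.
Variables (s : seq A) (r : nat).
Hypothesis rs : (r <= size s)%N.
Local Notation L := (br s).
Local Notation cm := (@commutator R).
Local Notation cmA := (@commutator A).

Let two_more a b : adspan r.+2 (cm (cm L (phi a)) (phi b)).
Proof. by rewrite !br_commutator; apply: adspan_br; rewrite !size_rcons. Qed.

(* Expand [L, ab, c]: modulo adspan r.+2, the form [L, a] [b, c] is alternating. *)
Let swap a b c : adspan r.+2 (cm L (phi a) * phi (cmA b c) + cm L (phi b) * phi (cmA a c)).
Proof.
set Q := cm L (phi a) * _; set Q' := cm L (phi b) * _.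
set P := phi a * cm (cm L (phi b)) (phi c); set P' := cm (cm L (phi a)) (phi c) * phi b.
set E := cm (phi (cmA a c)) (cm L (phi b)).
have -> : Q + Q' = cm (cm L (phi (a * b))) (phi c) - P - P' - E.
  rewrite rmorphM commutatorMr commutatorDl !commutatorMl -!rmorph_commutator.
  rewrite (mulrC_commutator (phi (cmA a c))) -/P -/P' -/Q -/Q' -/E.
  clearbody P P' E Q Q'; apply/eqP; rewrite eq_sym !subr_eq; apply/eqP.
  by rewrite -[LHS]addrA [LHS]addrC addrA (addrAC Q') (addrC Q').
have IE : adspan r.+2 E by rewrite /E -commutatorN; exact/adspanN/two_more.
apply: adspanB IE; apply: adspanB; last exact/adspanMr/two_more.
by apply: adspanB; [exact: two_more | exact/adspanMl/two_more].
Qed.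

(** By the Leibniz rule for [[b c, d]]; the factor [phi b] that lands after [[L, a]] moves to its
    left at the cost of [[L, a, b]]. *)
Let derive a b c d :
  adspan r.+2 (cm L (phi a) * phi (cmA b d)) ->
  adspan r.+2 (cm L (phi a) * phi (cmA c d)) ->
  adspan r.+2 (cm L (phi a) * phi (cmA (b * c) d)).
Proof.
move=> Ib Ic; rewrite commutatorMl rmorphD !rmorphM mulrDr.
apply: adspanD; last by rewrite mulrA; exact: adspanMr.
rewrite mulrA (mulrC_commutator (cm L (phi a))) mulrDl -mulrA.
by apply: adspanD; [exact: adspanMl | exact/adspanMr/two_more].
Qed.

Let flip a b c :
  adspan r.+2 (cm L (phi a) * phi (cmA b c)) -> adspan r.+2 (cm L (phi a) * phi (cmA c b)).
Proof. by rewrite -(commutatorN c b) rmorphN mulrN => /adspanN; rewrite opprK. Qed.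

Let form a b c := adspan r.+2 (cm L (phi a) * phi (cmA b c)).

Let formT a b c : form a b c -> form b a c.
Proof. by move=> Iabc; have := adspanB (swap b a c) Iabc; rewrite addrK. Qed.

Let form_ind a b : (forall i, form a << fmu i >> b) -> forall c, form a c b.
Proof.
move=> IX; apply: (@falg_ind _ _ (fun c => form a c b)) => [k|i|c d Ic Id|c d].
- rewrite /form (commutator_central (malgC_comm k b)).
  by rewrite rmorph0 mulr0; exact: adspan0.
- exact: IX.
- by rewrite /form (commutatorDl c d b) (rmorphD phi) mulrDr; exact: adspanD Ic Id.
- exact: derive.
Qed.

Let formaa a c : form a a c.
Proof. by apply: adspan_half; exact: swap. Qed.

(** Two of three elements of [bool] coincide, and an alternating form vanishes there. This is where
    having only two generators enters. *)
Let formX i j k : form << fmu i >> << fmu j >> << fmu k >>.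
Proof.
have [->|ij] := eqVneq i j; first exact: formaa.
have [->|jk] := eqVneq j k.
  by rewrite /form commutatorxx rmorph0 mulr0; exact: adspan0.
suff -> : i = k by exact/flip/formaa.
by case: i j k ij jk => [] [] [].
Qed.

(** From generators to arbitrary elements one argument at a time: [form_ind] extends the middle one,
    [flip] and [formT] bring the others there. *)
Lemma adspan_alternating a b c : adspan r.+2 (cm L (phi a) * phi (cmA b c)).
Proof.
have H1 i k d : form << fmu i >> d << fmu k >> by apply: form_ind => j; exact: formX.
have H2 i d e : form << fmu i >> d e by apply: form_ind => j; exact/flip/H1.
by apply/formT/form_ind => i; exact/formT/H2.
Qed.
End Alternation.

(** Since [r] is positive, each bracket is [[L, p]] for a shorter bracket [L] and a last entry [p],
    so the alternating form applies. *)
Lemma adspan_mul_commutator r x b c :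
  (0 < r)%N -> adspan r x -> adspan r.+1 (x * phi (commutator b c)).
Proof.
case: r => // r _; elim=> [|a s z rs _ IH]; first by rewrite mul0r; exact: adspan0.
rewrite mulrDl -mulrA; apply: adspanD IH; apply: adspanMl.
case/lastP: s rs => // s p; rewrite size_rcons ltnS -br_commutator => rs.
exact: adspan_alternating.
Qed.

(** In [[b m, a] = b [m, a] + [b, a] m] with [m] a bracket, the first term is longer by one entry;
    in the second, [[b, a]] is moved to the right of [m], where the previous lemma applies. *)
Lemma adspan_commutator r x a :
  (0 < r)%N -> adspan r x -> adspan r.+1 (commutator x (phi a)).
Proof.
move=> r0; elim=> [|b s z rs _ IH]; first by rewrite commutator0x; exact: adspan0.
rewrite commutatorDl; apply: adspanD IH; rewrite commutatorMl -rmorph_commutator.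
apply: adspanD; first by rewrite br_commutator; apply: adspan_gen; rewrite size_rcons.
rewrite mulrC_commutator; apply: adspanD.
  by apply: adspan_mul_commutator => //; exact: adspan_br.
rewrite -commutatorN; apply: adspanN; rewrite br_commutator.
by apply: adspan_br; rewrite size_rcons.
Qed.

(** Induction on the length of a generating commutator, through [[y, b] x = [y x, b] - y [x, b]]:
    each bracket on the left factor is traded for one that raises the filtration. *)
Lemma lower_mul_adspan r k a x : (0 < r)%N ->
  lower k a -> adspan r x -> adspan (r + k) (phi a * x).
Proof.
move=> r0 lower_a; move: a lower_a x.
apply: (@lower_ind _ k [set a | forall x, adspan r x -> adspan (r + k) (phi a * x)]).
  split=> [x _|a b Ia Ib x Ix|a b Ib x Ix|a b Ib x Ix] /=.
  - by rewrite rmorph0 mul0r; exact: adspan0.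
  - by rewrite rmorphB mulrBl; apply: adspanB; [exact: Ia | exact: Ib].
  - by rewrite rmorphM -mulrA; exact/adspanMl/Ib.
  - by rewrite rmorphM -mulrA; exact/Ib/adspanMl.
move=> a s <- /= x; elim/last_ind: s => [|s b IH] /= in r r0 x *.
  by rewrite addn0; exact: adspanMl.
rewrite rcons_commutator size_rcons addnS rmorph_commutator => Ix.
set y := phi (foldl _ _ _) in IH *.
have -> : commutator y (phi b) * x =
    commutator (y * x) (phi b) - y * commutator x (phi b).
  by rewrite commutatorMl addrC addKr.
apply: adspanB; first by apply: adspan_commutator (IH _ r0 _ Ix); rewrite addn_gt0 r0.
by rewrite -addSn; apply: IH => //; exact: adspan_commutator.
Qed.

Lemma adspan_sub_lower r : adspan r `<=` lower r.
Proof.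
move=> _x; elim=> {_x} [|a s x rs _ IH]; first exact: tsideal0 lower_ideal.
apply: (tsidealD (@lower_ideal R r)) IH; apply: (tsidealMl (@lower_ideal R r)).
by apply: lower_gen_le; rewrite size_map.
Qed.

Lemma lower_mul_br k a s : lower k a -> lower (size s + k) (phi a * br s).
Proof.
(* The empty word is treated apart because [lower_mul_adspan] asks for [0 < r]. *)
move=> lower_a; case: s => [|b s].
  by rewrite [size _]/= add0n; apply: (tsidealMr (@lower_ideal R k)); exact: lower_rmorph.
by apply: adspan_sub_lower; apply: lower_mul_adspan => //; exact: adspan_br.
Qed.
End AdjointSpan.

(** * Commutation raises the depth by one over two generators *)

Section TwoGenerators.
Variable K : fieldType.
Hypothesis two_neq0 : 2%:R != 0 :> K.
Local Notation A := {malg K[{fmonom bool}]}.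

Lemma lower_commutator k (a b : A) : lower k a -> lower k.+1 (commutator a b).
Proof.
case: k => [_|k]; first exact: (@lower_gen _ 1 a [:: b]).
(* The outer factors [u] and [v] make this set an ideal, so it suffices to check the generating
   commutators. *)
suff lowerJ : lower k.+1 `<=`
    [set a : A | forall u v c, lower k.+2 (commutator (u * a * v) c)].
  by move/lowerJ => /(_ 1 1 b); rewrite mul1r mulr1.
apply: lower_ind => [|l s sk u v c] /=.
  split=> [u v c|x y Ix Iy u v c|x y Iy u v c|x y Iy u v c] /=.
  - by rewrite mulr0 mul0r commutator0x; exact: tsideal0 lower_ideal.
  - rewrite mulrBr mulrBl commutatorBl.
    by apply: (tsidealB (@lower_ideal A k.+2)); [exact: Ix | exact: Iy].
  - by rewrite mulrA; exact: Iy.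
  - by rewrite mulrA -mulrA; exact: Iy.
apply: (@adspan_sub_lower _ _ idfun l).
apply: (@adspan_commutator K A two_neq0 idfun l k.+1 _ c) => //.
apply: (@adspanMr _ _ idfun l); rewrite -[s]map_id.
by apply: (@adspan_gen _ _ idfun l); rewrite sk.
Qed.
End TwoGenerators.

(** * Twisted derivations of the free algebra *)

Section TwistedWord.
Variables (I : Type) (A S : nzRingType) (L D : A -> S) (X : I -> A) (g : I -> S).

(** The rule [h (a * b) = L a * h b + h a * D b] with [h (X i) = g i], unfolded along a word. *)
Fixpoint tder_word (s : seq I) : S :=
  if s is i :: s' then L (X i) * tder_word s' + g i * D (foldr (fun i => *%R (X i)) 1 s')
  else 0.

End TwistedWord.

Section TwistedLeibniz.
Variables (K A S : nzRingType) (I : Type) (iota : {rmorphism K -> A}) (X : I -> A).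
Hypothesis iotaC : forall k a, GRing.comm a (iota k).
Local Notation word s := (foldr (fun i => *%R (X i)) 1 s).
Hypothesis A_ind : forall P : A -> Prop,
  P 0 -> (forall a b, P a -> P b -> P (a + b)) ->
  (forall c s, P (iota c * word s)) -> forall a, P a.
Variables (L D : {rmorphism A -> S}) (g : I -> S).
Hypothesis LC : forall k s, GRing.comm s (L (iota k)).
Hypothesis DC : forall k, D (iota k) = L (iota k).
Variable h : {additive A -> S}.
Hypothesis hU : forall c s, h (iota c * word s) = L (iota c) * tder_word L D X g s.

Let hC k : h (iota k) = 0.
Proof. by rewrite -[iota k]mulr1 (hU k [::]) mulr0. Qed.

Let hCM k a : h (iota k * a) = L (iota k) * h a.
Proof.
elim/A_ind: a => [|a b IHa IHb|c s].
- by rewrite mulr0 !raddf0 mulr0.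
- by rewrite mulrDr !raddfD IHa IHb -mulrDr.
by rewrite mulrA -rmorphM !hU !rmorphM mulrA.
Qed.

Let hXM i a : h (X i * a) = L (X i) * h a + g i * D a.
Proof.
elim/A_ind: a => [|a b IHa IHb|c s].
- by rewrite mulr0 !raddf0 !mulr0 addr0.
- by rewrite mulrDr !raddfD IHa IHb addrACA -!mulrDr.
rewrite mulrA iotaC -mulrA (hU c (i :: s)) hU /= rmorphM DC mulrDr !mulrA.
by rewrite LC (LC _ (g i)).
Qed.

Lemma tder_extX i : h (X i) = g i.
Proof. by rewrite -[X i]mulr1 hXM -(rmorph1 iota) hC mulr0 add0r !rmorph1 mulr1. Qed.

Lemma tder_extM a b : h (a * b) = L a * h b + h a * D b.
Proof.
elim/A_ind: a => [|a1 a2 IH1 IH2|c s].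
- by rewrite mul0r !raddf0 !mul0r addr0.
- by rewrite mulrDl !raddfD IH1 IH2 addrACA -!mulrDl.
rewrite -mulrA !hCM rmorphM -!mulrA -mulrDr; congr (_ * _).
elim: s => [|i s IH]; first by rewrite -(rmorph1 iota) hC mul0r addr0 rmorph1 !rmorph1 !mul1r.
by rewrite /= -mulrA !hXM IH !rmorphM mulrDl mulrDr !mulrA addrA.
Qed.

End TwistedLeibniz.

Section TwistedDerivation.
Variables (K : fieldType) (I : choiceType) (S : nzRingType).
Local Notation A := {malg K[{fmonom I}]}.
Variables (L D : {rmorphism A -> S}) (g : I -> S).
Hypothesis LC : forall k s, GRing.comm s (L k%:MP).
Hypothesis DC : forall k, D k%:MP = L k%:MP.

Definition tder : A -> S :=
  mmap (L \o @malgC _ _)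
    (fun m : {fmonom I} => tder_word L D (fun i => << fmu i >> : A) g (fmonom_val m)).

HB.instance Definition _ := GRing.Additive.on tder.

Let word_monom (s : seq I) :
  foldr (fun i => *%R (<< fmu i >> : A)) 1 s = << FMonom s >> :> A.
Proof. by elim: s => [|i s IH] /=; [rewrite -fmoneE | rewrite IH malgU_cons]. Qed.

Let tderU c s : tder (c%:MP * foldr (fun i => *%R (<< fmu i >> : A)) 1 s) =
  L c%:MP * tder_word L D (fun i => << fmu i >> : A) g s.
Proof. by rewrite word_monom -malgUMl; exact: mmapU. Qed.

Let word_ind (P : A -> Prop) : P 0 -> (forall a b, P a -> P b -> P (a + b)) ->
  (forall c s, P (c%:MP * foldr (fun i => *%R (<< fmu i >> : A)) 1 s)) -> forall a, P a.
Proof.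
by move=> P0 PD PU; apply: malg_ind => // c m; rewrite malgUMl -[m]fmK -word_monom.
Qed.

Lemma tderX i : tder << fmu i >> = g i.
Proof. exact: (tder_extX (@malgC_comm _ _) word_ind LC DC tderU). Qed.

Lemma tderM a b : tder (a * b) = L a * tder b + tder a * D b.
Proof. exact: (tder_extM (@malgC_comm _ _) word_ind LC DC tderU). Qed.

End TwistedDerivation.

Lemma subrACA (V : zmodType) (x y z t : V) : x - y - (z - t) = x - z - (y - t).
Proof. by rewrite !opprB addrACA [RHS]addrACA (addrC (- y)). Qed.

(** * Coefficients of products with a constant or a generator on the right *)

Section Coefficients.
Variables (R : nzRingType) (I : choiceType).
Local Notation B := {malg R[{fmonom I}]}.

Lemma mcoeffMC (m : B) c w : (m * c%:MP)@_w = m@_w * c.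
Proof.
elim/malg_ind: m => [|a b IHa IHb|d v].
- by rewrite mul0r !mcoeff0 mul0r.
- rewrite mulrDl 2!mcoeffD [RHS]mulrDl; exact: (f_equal2 +%R IHa IHb).
have -> : << d *g v >> * c%:MP = << d * c *g v >> :> B by rewrite [LHS]fgmulUU mulm1.
by transitivity ((d * c) *+ (v == w)); [exact: mcoeffU | rewrite mcoeffU mulrnAl].
Qed.

Let malgMX d v i : << d *g v >> * << fmu i >> = << d *g mmul v (fmu i) >> :> B.
Proof. by rewrite [LHS]fgmulUU mulr1. Qed.

Lemma mcoeffMX_nil (m : B) i : (m * << fmu i >>)@_(FMonom [::]) = 0.
Proof.
elim/malg_ind: m => [|a b IHa IHb|d v].
- by rewrite mul0r mcoeff0.
- by rewrite mulrDl mcoeffD -[RHS]addr0; exact: (f_equal2 +%R IHa IHb).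
rewrite malgMX mcoeffU fmP fmM fmU /= cats1.
by case: (fmonom_val v).
Qed.

Lemma mcoeffMX_rcons (m : B) i s j :
  (m * << fmu i >>)@_(FMonom (rcons s j)) = m@_(FMonom s) *+ (i == j).
Proof.
elim/malg_ind: m => [|a b IHa IHb|d v].
- by rewrite mul0r !mcoeff0 mul0rn.
- by rewrite mulrDl 2!mcoeffD mulrnDl; exact: (f_equal2 +%R IHa IHb).
rewrite malgMX.
transitivity (d *+ (mmul v (fmu i) == FMonom (rcons s j))); first exact: mcoeffU.
rewrite mcoeffU !fmP fmM fmU /= cats1 eqseq_rcons.
by case: (_ == s); case: (i == j).
Qed.

End Coefficients.

(** * Filtered bimodules and their twisted derivations *)

Section FilteredBimodule.
Variables (K A B : nzRingType) (I : Type) (iota : K -> A) (X : I -> A).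
Hypothesis A_ind : forall P : A -> Prop,
  (forall k, P (iota k)) -> (forall i, P (X i)) ->
  (forall a b, P a -> P b -> P (a + b)) ->
  (forall a b, P a -> P b -> P (a * b)) -> forall a, P a.
Variables L D : {rmorphism A -> B}.
Hypothesis LD_central : forall k m, m * D (iota k) = L (iota k) * m.

(** The commutator of [m] with [a] in the bimodule [B], where [A] acts on the left through [L] and
    on the right through [D]. *)
Definition twist (m : B) (a : A) : B := m * D a - L a * m.

Lemma mulr_twist m a : m * D a = L a * m + twist m a.
Proof. by rewrite /twist addrC subrK. Qed.

Lemma twistD m a b : twist m (a + b) = twist m a + twist m b.
Proof. by rewrite /twist !rmorphD mulrDr mulrDl opprD addrACA. Qed.

Lemma twistM m a b : twist m (a * b) = L a * twist m b + twist m a * D b.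
Proof. by rewrite /twist !rmorphM mulrBr mulrBl !mulrA [RHS]addrC subrKA. Qed.

Lemma mulr_twist_commutator m a b :
  m * D (commutator a b) = twist (m * D a) b - twist m b * D a.
Proof.
rewrite /twist /commutator rmorphB !rmorphM mulrBr mulrBl !mulrA opprB.
by rewrite [RHS]addrA subrK.
Qed.

(** The Jacobi identity in the bimodule. *)
Lemma twist_commutator m a b :
  twist m (commutator a b) = twist (twist m a) b - twist (twist m b) a.
Proof.
rewrite /twist /commutator !rmorphB !rmorphM !mulrBr !mulrBl !mulrA.
set p := m * D a * D b; set u := L a * m * D b; set v := L b * m * D a.
rewrite [RHS]subrACA [p - u - _]subrACA [v - _ - _]subrACA.
by rewrite -[v - u]opprB -opprD opprK addrA subrK opprB.
Qed.

Variable N : nat -> B -> Prop.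
Hypothesis N0 : forall m, N 0 m.
Hypothesis NB : forall k m p, N k m -> N k p -> N k (m - p).
Hypothesis NS : forall k m, N k.+1 m -> N k m.
Hypothesis NMl : forall k a m, N k m -> N k (L a * m).
Hypothesis N_lower : forall k a m, lower k a -> N k (L a * m).
Hypothesis N_twistX : forall k m i, N k m -> N k.+1 (twist m (X i)).

Let N_zero k : N k 0.
Proof. by rewrite -(mul0r 0) -(rmorph0 L); apply: N_lower; exact: tsideal0 lower_ideal. Qed.

Let ND k m p : N k m -> N k p -> N k (m + p).
Proof. by move=> Nm Np; rewrite -[p]opprK; apply: NB => //; rewrite -(sub0r p); exact: NB. Qed.

(** [twist m] obeys a Leibniz rule, so the generators suffice; a right factor [D b] is moved to the
    left by [mulr_twist]. *)
Lemma filtered_twist k m a : N k m -> N k.+1 (twist m a).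
Proof.
elim/A_ind: a k m => [c|i|a b IHa IHb|a b IHa IHb] k m Nm.
- by rewrite /twist LD_central subrr.
- exact: N_twistX.
- by rewrite twistD; apply: ND; [exact: IHa | exact: IHb].
rewrite twistM; apply: ND; first exact/NMl/IHb.
by rewrite mulr_twist; apply: ND; [exact/NMl/IHa | exact/NS/IHb/IHa].
Qed.

Lemma filteredMr k m a : N k m -> N k (m * D a).
Proof. by move=> Nm; rewrite mulr_twist; apply: ND; [exact: NMl | exact/NS/filtered_twist]. Qed.

Lemma filtered_twist_lcommutator k m a s : N k m ->
  N (k + (size s).+1) (twist m (foldl (@commutator _) a s)).
Proof.
elim/last_ind: s k m => [|s b IH] k m Nm; first by rewrite addn1; exact: filtered_twist.
rewrite rcons_commutator twist_commutator size_rcons; apply: NB.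
  by rewrite addnS; apply: filtered_twist; exact: IH.
by rewrite -addSnnS; apply: IH; exact: filtered_twist.
Qed.

(** [mulr_twist_commutator] trades the last bracket for a twist, before or after the multiplication,
    and each twist gains one step. *)
Lemma filteredMr_lcommutator k m a s : N k m ->
  N (k + size s) (m * D (foldl (@commutator _) a s)).
Proof.
elim/last_ind: s k m => [|s b IH] k m Nm; first by rewrite addn0; exact: filteredMr.
rewrite rcons_commutator mulr_twist_commutator size_rcons; apply: NB.
  by rewrite addnS; apply: filtered_twist; exact: IH.
by rewrite -addSnnS; apply: IH; exact: filtered_twist.
Qed.

Lemma filteredMr_lower k a m : lower k a -> N k (m * D a).
Proof.
move=> lower_a; move: a lower_a m.
apply: (@lower_ind _ k [set a | forall m, N k (m * D a)]); last first.
  by move=> a s <- m; exact: (@filteredMr_lcommutator 0).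
split=> [m|a b Na Nb m|b a Na m|b a Na m] /=.
- by rewrite rmorph0 mulr0.
- by rewrite rmorphB mulrBr; exact: NB.
- by rewrite rmorphM mulrA; exact: Na.
- by rewrite rmorphM mulrA; exact/filteredMr/Na.
Qed.

Variable h : {additive A -> B}.
Hypothesis hM : forall a b, h (a * b) = L a * h b + h a * D b.

Let h_commutator a b : h (commutator a b) = twist (h a) b - twist (h b) a.
Proof.
by rewrite /commutator raddfB !hM /twist opprB addrACA -opprD [L a * _ + _]addrC.
Qed.

(** In the application [1] stands for the extra variable [z], and [L a - D a] for [[a, z]]. *)
Lemma tder_commutator a x : h x = 1 -> h (commutator a x) = L a - D a + twist (h a) x.
Proof.
move=> hx; rewrite /commutator raddfB !hM hx mulr1 mul1r /twist.
by rewrite [L x * _ + _]addrC opprD addrACA.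
Qed.

Lemma filtered_tder k a : lower k a -> N k (h a).
Proof.
move=> lower_a.
(* Membership of [a] itself is carried along: the Leibniz rule also produces products of [L a] and
   [D a] with arbitrary values of [h]. *)
suff lowerJ : @lower A k `<=` [set a | lower k a /\ N k (h a)].
  by case: (lowerJ a lower_a).
apply: lower_ind => {a lower_a} [|a s sk] /=.
  split=> [|a b [Ia Na] [Ib Nb]|b a [Ia Na]|b a [Ia Na]] /=.
  - by rewrite raddf0; split; [exact: tsideal0 lower_ideal | exact: N_zero].
  - by rewrite raddfB; split; [exact: tsidealB lower_ideal _ _ Ia Ib | exact: NB].
  - split; first exact: tsidealMl lower_ideal _ _ Ia.
    by rewrite hM; apply: ND; [exact: NMl | exact: filteredMr_lower].
  - split; first exact: tsidealMr lower_ideal _ _ Ia.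
    by rewrite hM; apply: ND; [exact: N_lower | exact: filteredMr].
split; first exact: lower_gen.
rewrite -sk {k sk}; elim/last_ind: s => [|s b IH]; first exact: N0.
rewrite rcons_commutator h_commutator size_rcons; apply: NB.
  exact: filtered_twist.
exact: (@filtered_twist_lcommutator 0).
Qed.
End FilteredBimodule.

(** * The part linear in an extra variable *)

Section LinearPart.
Variables (K A : nzRingType) (iota : K -> A) (X : bool -> A).
Hypothesis A_ind : forall P : A -> Prop,
  (forall k, P (iota k)) -> (forall i, P (X i)) ->
  (forall a b, P a -> P b -> P (a + b)) ->
  (forall a b, P a -> P b -> P (a * b)) -> forall a, P a.
Hypothesis iotaC : forall k a, GRing.comm a (iota k).
Hypothesis lower_commutatorA : forall k (a b : A), lower k a -> lower k.+1 (commutator a b).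
(* The part of the free algebra that is linear in an extra variable z: the word
   w_1 ... w_j with coefficient a stands for a [z, w_1, ..., w_j]. Under this
   identification A acts on the left through constants and, since
   u x = x u + [u, x], on the right through [coact]. *)
Local Notation B := {malg A[{fmonom bool}]}.
Variable coact : {rmorphism A -> B}.
Hypothesis coactC : forall k, coact (iota k) = (iota k)%:MP.
Hypothesis coactX : forall i, coact (X i) = (X i)%:MP + << fmu i >>.

Local Notation const := (@malgC {fmonom bool} A).
Local Notation twist := (twist const coact).

(* Truncated subtraction: no condition on words of length at least k. *)
Definition graded_lower k (m : B) := forall w : {fmonom bool}, lower (k - fdeg w) m@_w.

Lemma graded_lower0 m : graded_lower 0 m.
Proof. by move=> w; exact: lower0. Qed.

Lemma graded_lower_le j k m : (j <= k)%N -> graded_lower k m -> graded_lower j m.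
Proof. by move=> jk Nm w; apply: lower_le (Nm w); exact: leq_sub2r. Qed.

Lemma graded_lowerB k m p : graded_lower k m -> graded_lower k p -> graded_lower k (m - p).
Proof. by move=> Nm Np w; rewrite mcoeffB; exact: tsidealB lower_ideal _ _ (Nm w) (Np w). Qed.

Lemma graded_lowerMl k a m : graded_lower k m -> graded_lower k (a%:MP * m).
Proof. by move=> Nm w; rewrite mcoeffCM; exact: tsidealMl lower_ideal _ _ (Nm w). Qed.

Lemma graded_lower_mull k a m : lower k a -> graded_lower k (a%:MP * m).
Proof.
move=> lower_a w; rewrite mcoeffCM; apply: (tsidealMr lower_ideal).
by apply: lower_le lower_a; exact: leq_subr.
Qed.

(** Coefficientwise this is [[a v, x] = [a, x] v + a [v, x]] with [v] a bracket in [z] and [x] a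
    generator: the second term appends a letter to the word. *)
Lemma twistXE m i w :
  (twist m (X i))@_w = commutator m@_w (X i) + (m * << fmu i >>)@_w.
Proof.
have -> : twist m (X i) = m * (X i)%:MP - (X i)%:MP * m + m * << fmu i >>.
  by rewrite /twist coactX mulrDr addrAC.
rewrite mcoeffD mcoeffB.
exact: (congr1 (+%R^~ _) (f_equal2 (fun u v => u - v) (mcoeffMC _ _ _) (mcoeffCM _ _ _))).
Qed.

Lemma twistX_rcons m i s j :
  (twist m (X i))@_(FMonom (rcons s j)) =
  commutator m@_(FMonom (rcons s j)) (X i) + m@_(FMonom s) *+ (i == j).
Proof. by rewrite twistXE mcoeffMX_rcons. Qed.

(** Bracketing deepens each coefficient by one, and appending a letter lowers the required depth by
    one. *)
Lemma graded_lower_twistX k m i : graded_lower k m -> graded_lower k.+1 (twist m (X i)).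
Proof.
move=> Nm w.
have Nc : lower (k.+1 - fdeg w) (commutator m@_w (X i)).
  apply: lower_le (lower_commutatorA (X i) (Nm w)).
  by rewrite leq_subLR addnS ltnS -leq_subLR.
case: w Nc => s; case/lastP: s => [|s j] Nc; first by rewrite twistXE mcoeffMX_nil addr0.
rewrite twistX_rcons; apply: (tsidealD lower_ideal) => //.
case: eqP => _; last exact: tsideal0 lower_ideal.
by have := Nm (FMonom s); rewrite !fdegE /= size_rcons subSS.
Qed.

(* Descending induction on the length of the words: the coefficients of H0 and H1
   at s are, up to commutators with coefficients at longer words, the coefficients
   of the hypothesis at s x and s y. *)
Lemma graded_lower_twistX_inj q H0 H1 :
  graded_lower q (twist H0 (X false) - twist H1 (X true)) ->
  graded_lower q.-1 H0 /\ graded_lower q.-1 H1.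
Proof.
move=> NE.
suff H d (s : seq bool) : (q.-1 - size s <= d)%N ->
    lower (q.-1 - size s) H0@_(FMonom s) /\ lower (q.-1 - size s) H1@_(FMonom s).
  by split=> w; rewrite fdegE; case: (H _ (fmonom_val w) (leqnn _)); rewrite fmK.
elim: d s => [|d IH] s qd.
  by move: qd; rewrite leqn0 => /eqP ->; split; exact: lower0.
have [->|q_gt] := posnP (q.-1 - size s); first by split; exact: lower0.
have step j : lower (q.-1 - size s) (commutator H0@_(FMonom (rcons s j)) (X false)) /\
              lower (q.-1 - size s) (commutator H1@_(FMonom (rcons s j)) (X true)).
  case: (IH (rcons s j)) => [|N0 N1]; first by rewrite size_rcons subnS -ltnS prednK.
  move: (lower_commutatorA (X false) N0) (lower_commutatorA (X true) N1).
  by rewrite size_rcons subnS prednK.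
have coeff j : lower (q.-1 - size s)
    (H0@_(FMonom s) *+ (false == j) - H1@_(FMonom s) *+ (true == j)).
  have [N0 N1] := step j.
  have := NE (FMonom (rcons s j)); rewrite fdegE /= size_rcons subnS predn_sub.
  rewrite (etrans (mcoeffB _ _ _) (f_equal2 (fun u v => u - v)
    (twistX_rcons H0 false s j) (twistX_rcons H1 true s j))).
  rewrite opprD addrACA => /(tsidealB lower_ideal).
  move=> /(_ _ (tsidealB lower_ideal N0 N1)).
  by rewrite [X in lower _ X -> _]addrAC subrr add0r.
split; first by have := coeff false; rewrite /= subr0.
by have := coeff true; rewrite /= sub0r => /(tsidealN lower_ideal); rewrite opprK.
Qed.

Variable h : bool -> {additive A -> B}.
Hypothesis hM : forall i a b, h i (a * b) = a%:MP * h i b + h i a * coact b.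
Hypothesis hX : forall i j, h i (X j) = (i == j)%:R.

(** [h i] linearizes [[f, X i]] along [X i |-> X i + z]; both linearizations contain
    [f%:MP - coact f], which stands for [[f, z]]. *)
Lemma graded_lower_coactB q f : (forall i, lower q (commutator f (X i))) ->
  graded_lower q (f%:MP - coact f).
Proof.
move=> cf.
have LD k m : m * coact (iota k) = const (iota k) * m.
  by rewrite coactC; apply: malgC_central => a; exact: iotaC.
have NS k m : graded_lower k.+1 m -> graded_lower k m by exact: graded_lower_le.
have Nh i : graded_lower q (f%:MP - coact f + twist (h i f) (X i)).
  suff <- : h i (commutator f (X i)) = f%:MP - coact f + twist (h i f) (X i).
    exact: (filtered_tder A_ind LD graded_lower0 graded_lowerB NS graded_lowerMl
      graded_lower_mull graded_lower_twistX (hM i) (cf i)).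
  by apply: (tder_commutator (hM i)); rewrite hX eqxx.
have [N0 N1] : graded_lower q.-1 (h false f) /\ graded_lower q.-1 (h true f).
  apply: graded_lower_twistX_inj.
  (* The difference cancels [[f, z]] and leaves only the two twists. *)
  have := graded_lowerB (Nh false) (Nh true).
  by rewrite opprD addrACA subrr add0r.
(* Twisting regains the step lost in [q.-1], so the correction term can be removed at depth [q]. *)
have := graded_lowerB (Nh false) (graded_lower_le (leqSpred q) (graded_lower_twistX false N0)).
by rewrite addrK.
Qed.

Variables (R : nzRingType) (phi : {rmorphism A -> R}) (z : R).
Hypothesis phiC : forall k r, GRing.comm r (phi (iota k)).
Hypothesis lower_phi : forall k a s, lower k a ->
  lower (size s + k) (phi a * foldl (@commutator R) z (map phi s)).

(** Reads the formal words as actual brackets of [z] in [R]; [bracket_evalMl] and [bracket_evalMr]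
    make it a map of bimodules. *)
Definition bracket_eval : B -> R :=
  mmap phi (fun w : {fmonom bool} =>
    foldl (@commutator R) z (map (phi \o X) (fmonom_val w))).

HB.instance Definition _ := GRing.Additive.on bracket_eval.

Let evalU a s : bracket_eval << a *g FMonom s >> =
  phi a * foldl (@commutator R) z (map (phi \o X) s).
Proof. exact: mmapU. Qed.

Lemma bracket_eval1 : bracket_eval 1 = z.
Proof. by rewrite -[1]/(<< 1 *g mone >>) -[mone]fmK evalU /= fm1 rmorph1 mul1r. Qed.

Lemma bracket_evalMl a m : bracket_eval (a%:MP * m) = phi a * bracket_eval m.
Proof.
elim/malg_ind: m => [|m p IHm IHp|c w].
- by rewrite mulr0 !raddf0 mulr0.
- by rewrite mulrDr 2!raddfD [RHS]mulrDr; exact: (f_equal2 +%R IHm IHp).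
by rewrite malgCMU -[w]fmK !evalU rmorphM mulrA.
Qed.

Let evalMX m i :
  bracket_eval (m * coact (X i)) = bracket_eval m * phi (X i).
Proof.
elim/malg_ind: m => [|m p IHm IHp|c w].
- by rewrite mul0r !raddf0 mul0r.
- by rewrite mulrDl 2!raddfD [RHS]mulrDl; exact: (f_equal2 +%R IHm IHp).
rewrite coactX mulrDr raddfD.
have -> : << c *g w >> * (X i)%:MP = << c * X i *g FMonom (fmonom_val w) >> :> B.
  by rewrite [LHS]fgmulUU mulm1 fmK.
have -> : << c *g w >> * << fmu i >> = << c *g FMonom (rcons (fmonom_val w) i) >> :> B.
  rewrite [LHS]fgmulUU mulr1; congr << _ *g _ >>.
  by apply/eqP; rewrite fmP fmM fmU cats1.
rewrite -[w in RHS]fmK /= !evalU map_rcons rcons_commutator rmorphM -!mulrA -mulrDr.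
by rewrite /commutator addrCA subrr addr0.
Qed.

Lemma bracket_evalMr m a : bracket_eval (m * coact a) = bracket_eval m * phi a.
Proof.
elim/A_ind: a m => [k|i|a b IHa IHb|a b IHa IHb] m.
- rewrite coactC (malgC_central m (iotaC k)) bracket_evalMl; exact/commr_sym/phiC.
- exact: evalMX.
- by rewrite !rmorphD !mulrDr raddfD; exact: (f_equal2 +%R (IHa m) (IHb m)).
by rewrite !rmorphM !mulrA IHb IHa.
Qed.

Lemma lower_bracket_eval q m : graded_lower q m -> lower q (bracket_eval m).
Proof.
move=> Nm; rewrite /bracket_eval mmapE; apply: big_ind => [|a b Na Nb|w _].
- exact: tsideal0 lower_ideal.
- exact: tsidealD lower_ideal _ _ Na Nb.
have := @lower_phi _ _ (map X (fmonom_val w)) (Nm w); rewrite -map_comp size_map.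
by apply: lower_le; rewrite -leq_subLR fdegE.
Qed.

(** [bracket_eval] sends [1] to [z], hence [f%:MP - coact f] to [[phi f, z]]. *)
Lemma lower_commutator_central q f : (forall i, lower q (commutator f (X i))) ->
  lower q (commutator (phi f) z).
Proof.
move=> /graded_lower_coactB /lower_bracket_eval.
rewrite -[f%:MP]mulr1 -[coact f]mul1r raddfB /= bracket_evalMl bracket_evalMr.
by rewrite bracket_eval1.
Qed.
End LinearPart.

(** * The concrete linearization over two generators *)

Section TwoGenerated.
Variable K : fieldType.
Hypothesis two_neq0 : 2%:R != 0 :> K.
Local Notation A := {malg K[{fmonom bool}]}.
Local Notation B := {malg A[{fmonom bool}]}.
Local Notation X := (fun i : bool => << fmu i >> : A).

Let iota : K -> B := @malgC {fmonom bool} A \o @malgC {fmonom bool} K.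

HB.instance Definition _ := GRing.RMorphism.on iota.

Let iotaC k (b : B) : GRing.comm b (iota k).
Proof. by apply: malgC_central => a; exact: malgC_comm. Qed.

Let coact : {rmorphism A -> B} := feval (fun i => (X i)%:MP + << fmu i >>) iotaC.

Let coactC k : coact k%:MP = k%:MP%:MP.
Proof. exact: fevalC. Qed.

Let coactX i : coact (X i) = (X i)%:MP + << fmu i >>.
Proof. exact: fevalX. Qed.

(** Sums over the occurrences of the generator [i] in a word, each replaced by [z]: what precedes
    acts on the left, what follows acts on the right through [coact]. *)
Let h i : {additive A -> B} := tder (@malgC {fmonom bool} A) coact (fun j => (i == j)%:R).

Let hM i a b : h i (a * b) = a%:MP * h i b + h i a * coact b.
Proof. exact: tderM iotaC coactC a b. Qed.

Let hX i j : h i (X j) = (i == j)%:R.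
Proof. exact: tderX iotaC coactC j. Qed.

Lemma lower_commutator_rmorph (R : nzRingType) (phi : {rmorphism A -> R}) (z : R) q f :
  (forall k r, GRing.comm r (phi k%:MP)) ->
  (forall i, lower q (commutator f (X i))) -> lower q (commutator (phi f) z).
Proof.
move=> phiC.
apply: (lower_commutator_central (@falg_ind K bool) (@malgC_comm K bool)
  (lower_commutator two_neq0) coactC coactX hM hX phiC) => k a s.
exact: lower_mul_br.
Qed.

End TwoGenerated.

(** * Transfer to the relatively free algebra *)

(** A commutator of [n.+1] entries has [n] brackets. *)
Lemma T_idealE (K : fieldType) n : @T_ideal K n.+1 = @lower (free_alg K) n.
Proof.
apply/seteqP; split=> x Tx I [idI genI]; apply: Tx; split=> // y.
  move=> [[[|a s] /= sn] _ <-] //; apply: genI; exists (a, s) => //=.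
  by apply/eqP; rewrite -eqSS.
move=> [[a s] /= sn <-]; apply: genI.
by exists (@Tuple _ _ (a :: s) (introT eqP (congr1 S sn))).
Qed.

Section RelFree.
Variables (K : fieldType) (n : nat) (n_gt1 : (1 < n)%N).
Hypothesis two_neq0 : 2%:R != 0 :> K.
Local Notation F := (free_alg K).
Local Notation A := {malg K[{fmonom bool}]}.
Local Notation Q := (rel_free K n_gt1).

Let pi_eqP (x y : F) : reflect (@T_ideal K n (x - y)) (\pi_Q%qT x == \pi_Q%qT y).
Proof. exact: (quot_algP (@ideal_gen_ideal _ _) (T_ideal_proper n_gt1)). Qed.

Section Retraction.
Variables (incl : {rmorphism A -> F}) (retr : {rmorphism F -> A}).
Hypothesis inclC : forall k, incl k%:MP = k%:MP.
Hypothesis retrC : forall k, retr k%:MP = k%:MP.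
Hypothesis inclX : forall b : bool, incl << fmu b >> = freeX K b.
Hypothesis retrX : forall b : bool, retr (freeX K b) = << fmu b >>.

Let inclZ k a : incl (k *: a) = k *: incl a.
Proof. by rewrite -[k *: a]mul_malgC rmorphM inclC; exact: mul_malgC. Qed.

Let retrZ k a : retr (k *: a) = k *: retr a.
Proof. by rewrite -[k *: a]mul_malgC rmorphM retrC; exact: mul_malgC. Qed.

(** The condition [incl (retr g) = g] puts the lift [g] in the subalgebra of the first two
    generators. *)
Let rel_free2_lift z : rel_free2 K n_gt1 z ->
  exists2 g : F, \pi_Q%qT g = z & incl (retr g) = g.
Proof.
move=> /(_ [set z | exists2 g : F, \pi_Q%qT g = z & incl (retr g) = g]); apply; split.
  split=> [|k u v|u v]; rewrite !in_setE /=.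
  - by exists 1; [exact: rmorph1 | rewrite !rmorph1].
  - move=> [a <- aE] [b <- bE]; exists (k *: a + b).
      by apply: etrans (rmorphD _ _ _) _; congr (_ + _); exact: pi_qscale.
    rewrite (rmorphD retr) (rmorphD incl) retrZ inclZ.
    exact: (f_equal2 (fun x y => k *: x + y) aE bE).
  - move=> [a <- aE] [b <- bE]; exists (a * b); first exact: rmorphM.
    by rewrite (rmorphM retr) (rmorphM incl); exact: (f_equal2 *%R aE bE).
move=> _ [->|->].
- by exists (freeX K 0) => //; rewrite (retrX false) inclX.
- by exists (freeX K 1) => //; rewrite (retrX true) inclX.
Qed.

(** The relations between a lift and the two generators are retracted to [A], where depth is
    controlled; the result there then gives commutators with all of the free algebra. *)
Lemma center_rel_free2_commutes z u : center (rel_free2 K n_gt1) z -> GRing.comm z u.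
Proof.
move=> [z2 zC]; have [g gz gE] := rel_free2_lift z2.
have gX (i : bool) : lower n.-1 (commutator (retr g) << fmu i >>).
  rewrite -retrX -rmorph_commutator; apply: lower_rmorph.
  rewrite -T_idealE prednK ?(ltnW n_gt1) //; apply/pi_eqP/eqP.
  have Xi : rel_free2 K n_gt1 (\pi_Q%qT (freeX K i)).
    by move=> S [_]; apply; case: i; [right | left].
  have := zC _ Xi; rewrite -gz => E.
  by apply: etrans (rmorphM _ _ _) (etrans E (esym (rmorphM _ _ _))).
have gF (v : F) : @T_ideal K n (commutator g v).
  rewrite -(prednK (ltnW n_gt1)) T_idealE -gE.
  apply: (lower_commutator_rmorph two_neq0) gX => k r.
  by rewrite inclC; exact: malgC_comm.
have piE : z * \pi_Q%qT (repr u) = \pi_Q%qT (repr u) * z.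
  rewrite -gz; have /pi_eqP/eqP E := gF (repr u).
  by apply: etrans (esym (rmorphM _ _ _)) (etrans E (rmorphM _ _ _)).
by move: piE; rewrite reprK.
Qed.
End Retraction.

Lemma center_rel_free2_sub : center (rel_free2 K n_gt1) `<=` center [set: Q].
Proof.
move=> z zC; split=> // u _.
pose incl : {rmorphism A -> F} :=
  feval (iota := @malgC {fmonom nat} K) (fun b : bool => freeX K b) (@malgC_comm K nat).
pose retr : {rmorphism F -> A} :=
  feval (iota := @malgC {fmonom bool} K)
    (* Only the images of the first two generators matter; the others are sent to [0]. *)
    (fun i => if i is 0 then << fmu false >> else if i is 1 then << fmu true >> else 0)
    (@malgC_comm K bool).
apply: (@center_rel_free2_commutes incl retr) zC.
- by move=> k; exact: fevalC.
- by move=> k; exact: fevalC.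
- by move=> b; exact: fevalX.
- by move=> b; apply: etrans (fevalX _ _ _) _; case: b.
Qed.
End RelFree.

Local Close Scope ring_scope.

Theorem mainTheorem5 (K : fieldType) (n : nat)
    (K_inf : infinite_set [set: K])
    (char_neq2 : 2 \notin [pchar K]%R) (char_neq3 : 3 \notin [pchar K]%R)
    (n_ge3 : 3 <= n) :
  center (rel_free2 K (ltnW n_ge3)) =
  rel_free2 K (ltnW n_ge3) `&` center [set: rel_free K (ltnW n_ge3)].
Proof.
have two_neq0 : (2%:R != 0 :> K)%R by move: char_neq2; rewrite inE.
apply/seteqP; split=> [z zC|z [z2 [_ zC]]]; last by split=> // u _; exact: zC.
by split; [case: zC | exact: center_rel_free2_sub zC].
Qed.
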